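(* Let $S$ be a scheme, let $\phi\colon X\dashrightarrow Y$ and $\psi\colon Y\dashrightarrow Z$ be $S$-rational morphisms of schemes over $S$, and suppose $\phi$ is $S$-diffuse. Then: (1) There exist representatives $\phi_U$ of $\phi$ and $\psi_V$ of $\psi$ such that $\phi_U(U)\subset V$. (2) The $S$-rational morphism from $X$ to $Z$ induced by $\psi_V\circ\phi_U$ is independent of the choice of representatives $\phi_U,\psi_V$ with this property.
   Context: A morphism $f\colon X\to Y$ of $S$-schemes is schematically dominant if $\mathcal O_Y\to f_*\mathcal O_X$ is injective, and $S$-dominant if it remains so after every base change $S'\to S$. An open $U\subset X$ is $S$-dense if $U\hookrightarrow X$ is $S$-dominant. An $S$-rational morphism $\phi\colon X\dashrightarrow Y$ is an equivalence class of pairs $(U,\phi_U)$ (called representatives, denoted $\phi_U$), where $U\subset X$ is an $S$-dense open and $\phi_U\colon U\to Y$ is a morphism over $S$; $(U,\phi_U)$ and $(U',\phi_{U'})$ are equivalent if they agree on some $S$-dense open $U''\subset U\cap U'$. A morphism $f\colon X\to Y$ is $S$-diffuse if $f^{-1}(V)$ is $S$-dense in $X$ for every $S$-dense open $V\subset Y$; an $S$-rational morphism is $S$-diffuse if one (equivalently, any) of its representatives is. *)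

(* Defs.v *)
From HB Require Import structures.
From mathcomp Require Import all_boot all_algebra.
From mathcomp Require Import all_classical topology.

Set Implicit Arguments.
Unset Strict Implicit.
Unset Printing Implicit Defensive.

Import GRing.Theory.
Local Open Scope classical_set_scope.
Local Open Scope ring_scope.

(* Lets records coercing to [set T] be applied to points. *)
Identity Coercion set_app : set >-> Funclass.

(* Rings are commutative and possibly zero ([comPzRingType]): the ring of      *)
(* sections over the empty set is the zero ring.                               *)

Definition is_unit (A : comPzRingType) (x : A) : Prop := exists y, x * y = 1.

(* [g : A -> B] exhibits [B] as the localization A_f, that is, it induces an   *)
(* isomorphism A_f -> B.                                                       *)
Definition is_localization (A B : comPzRingType) (f : A) (g : A -> B) : Prop :=
  [/\ is_unit (g f),
      forall b, exists n a, b * g f ^+ n = g a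
    & forall a, g a = 0 -> exists n, f ^+ n * a = 0].

Record spec (A : comPzRingType) := PrimeIdeal {
  pset :> set A;
  pset0 : pset 0;
  psetD : forall x y, pset x -> pset y -> pset (x + y);
  psetMl : forall a x, pset x -> pset (a * x);
  pset1 : ~ pset 1;
  psetM : forall x y, pset (x * y) -> pset x \/ pset y }.

Lemma spec_eq (A : comPzRingType) (p q : spec A) :
  (forall x, p x <-> q x) -> p = q.
Proof.
case: p q => [p p0 pD pMl p1 pM] [q q0 qD qMl q1 qM] /= pq.
have {}pq : p = q by apply/seteqP; split => x /pq.
by case: _ / pq in q0 qD qMl q1 qM *; congr PrimeIdeal; exact: Prop_irrelevance.
Qed.

HB.instance Definition _ (A : comPzRingType) := gen_eqMixin (spec A).
HB.instance Definition _ (A : comPzRingType) := gen_choiceMixin (spec A).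

Definition basic_open (A : comPzRingType) (f : A) : set (spec A) :=
  [set p : spec A | ~ p f].

Definition zariski_open (A : comPzRingType) (D : set (spec A)) : Prop :=
  exists E : set A, D = \bigcup_(f in E) basic_open f.

Lemma basic_openM (A : comPzRingType) (f g : A) :
  basic_open (f * g) = basic_open f `&` basic_open g.
Proof.
apply/seteqP; split => [p pfg|p [pf pg] /psetM [//|//]].
by split => ph; apply: pfg; [rewrite mulrC|]; exact: psetMl.
Qed.

Lemma zariski_openT (A : comPzRingType) : zariski_open [set: spec A].
Proof.
exists [set 1]; rewrite bigcup_set1; apply/seteqP; split => // p _.
exact: pset1.
Qed.

Lemma zariski_openI (A : comPzRingType) : setI_closed (@zariski_open A).
Proof.
move=> _ _ [E ->] [F ->]; exists [set e * f | e in E & f in F].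
apply/seteqP; split => [p [[e Ee pe] [f Ff pf]]|p [_ [e Ee [f Ff <-]]]].
  by exists (e * f); [exists e => //; exists f|rewrite basic_openM].
by rewrite basic_openM => -[pe pf]; split; [exists e|exists f].
Qed.

Lemma zariski_open_bigU (A : comPzRingType) (I : Type) (D : I -> set (spec A)) :
  (forall i, zariski_open (D i)) -> zariski_open (\bigcup_i D i).
Proof.
move=> oD; exists [set f | exists i, basic_open f `<=` D i].
apply/seteqP; split => [p [i _]|p [f [i fD] pf]]; last by exists i => //; apply: fD.
have [E DE] := oD i; rewrite {1}DE => -[f Ef pf]; exists f => //.
by exists i; rewrite DE => q qf; exists f.
Qed.

HB.instance Definition _ (A : comPzRingType) :=
  isOpenTopological.Build (spec A) (@zariski_openT A) (@zariski_openI A)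
    (@zariski_open_bigU A).

Record opens (X : topologicalType) := Opens {
  oset :> set X;
  open_oset : open oset }.

Record ringed_space := RingedSpace {
  points :> topologicalType;
  sec : opens points -> comPzRingType;
  res : forall U V : opens points, V `<=` U -> {rmorphism sec U -> sec V};
  res_id : forall (U : opens points) (h : U `<=` U) (s : sec U), res h s = s;
  res_comp : forall (U V W : opens points) (hU : V `<=` U) (hV : W `<=` V)
    (h : W `<=` U) (s : sec U), res hV (res hU s) = res h s;
  glue : forall (I : Type) (U : opens points) (V : I -> opens points)
    (hV : forall i, V i `<=` U), U `<=` \bigcup_i V i ->
    forall s : forall i, sec (V i),
    (forall i j (W : opens points) (hi : W `<=` V i) (hj : W `<=` V j),
       res hi (s i) = res hj (s j)) ->
    exists! t : sec U, forall i, res (hV i) t = s i }.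

(* The germ at [x] of the section [s] is a unit of the stalk at [x]. *)
Definition unit_at (X : ringed_space) (x : X) (U : opens X) (s : sec U) : Prop :=
  exists (V : opens X) (h : V `<=` U), V x /\ is_unit (res h s).

(* Stalks are local rings: 0 is not a unit, and the sum of two nonunits is a   *)
(* nonunit.  Two germs are always represented over a common neighbourhood.     *)
Definition local_stalks (X : ringed_space) : Prop :=
  forall (x : X) (U : opens X), U x ->
    ~ unit_at x (0 : sec U) /\
    forall s t : sec U, unit_at x (s + t) -> unit_at x s \/ unit_at x t.

(* The open [W] with the induced structure sheaf is isomorphic to Spec A: [j]  *)
(* is a homeomorphism of Spec A onto [W], and [a : A -> sec W] induces         *)
(* isomorphisms A_f -> sec (j (D f)); the D f form a basis of Spec A, so this  *)
(* determines the sheaf, whose sections over D f are A_f.                      *)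
Definition is_affine_open (X : ringed_space) (W : opens X) : Prop :=
  exists (A : comPzRingType) (j : spec A -> X) (a : {rmorphism A -> sec W}),
  [/\ injective j,
      range j = W,
      forall D : set (spec A), open D <-> open (j @` D)
    & forall (f : A) (V : opens X) (h : V `<=` W),
        V = j @` basic_open f :> set X -> is_localization f (res h \o a)].

Record scheme := Scheme {
  scheme_space :> ringed_space;
  scheme_local : local_stalks scheme_space;
  scheme_affine : forall x : scheme_space,
    exists2 W : opens scheme_space, W x & is_affine_open W }.

Lemma open_subset_image (X : topologicalType) (U : opens X)
  (W : set (set_type U)) : open W -> open (val @` W).
Proof.
case=> B oB <-; rewrite (_ : _ @` _ = B `&` U); last first.
  apply/seteqP; split => [_ [x Bx <-]|x [Bx Ux]]; first by split; [|exact: set_valP].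
  by exists (SigSub (mem_set Ux)).
by apply: openI => //; exact: open_oset.
Qed.

Definition image_open (X : topologicalType) (U : opens X)
    (W : opens (set_type U)) : opens X :=
  Opens (open_subset_image (open_oset W)).

Lemma open_subset_preimage (X : topologicalType) (U B : opens X) :
  open (val @^-1` B : set (set_type U)).
Proof. by exists B => //; exact: open_oset. Qed.

Definition trace_open (X : topologicalType) (U B : opens X) :
  opens (set_type U) := Opens (open_subset_preimage U B).

Lemma image_openS (X : topologicalType) (U : opens X)
  (V W : opens (set_type U)) : W `<=` V -> image_open W `<=` image_open V.
Proof. by move=> WV _ [x Wx <-]; exists x => //; exact: WV. Qed.

Lemma image_open_sub (X : topologicalType) (U : opens X)
  (W : opens (set_type U)) : image_open W `<=` U.
Proof. by move=> _ [x _ <-]; exact: set_valP. Qed.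

Lemma image_openP (X : topologicalType) (U : opens X)
  (W : opens (set_type U)) (x : set_type U) : image_open W (val x) <-> W x.
Proof. by split => [[y Wy /val_inj <-]//|Wx]; exists x. Qed.

Lemma trace_openK (X : topologicalType) (U B : opens X) :
  B `<=` U -> image_open (trace_open U B) = B :> set X.
Proof.
move=> BU; apply/seteqP; split => [_ [x Bx <-]//|x Bx].
by exists (SigSub (mem_set (BU _ Bx))).
Qed.

Lemma open_subspace_glue (X : ringed_space) (O : opens X) (I : Type)
    (U : opens (set_type O)) (V : I -> opens (set_type O))
    (hV : forall i, V i `<=` U) : U `<=` \bigcup_i V i ->
    forall s : forall i, sec (image_open (V i)),
    (forall i j (W : opens (set_type O)) (hi : W `<=` V i) (hj : W `<=` V j),
       res (image_openS hi) (s i) = res (image_openS hj) (s j)) ->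
    exists! t : sec (image_open U), forall i, res (image_openS (hV i)) t = s i.
Proof.
move=> UV s sE; apply: glue => [_ [x /UV[i _ Vx] <-]|i j W hi hj].
  by exists i => //; exists x.
have WO : W `<=` O by move=> x /hi /image_open_sub.
have ki : trace_open O W `<=` V i by move=> x /hi /image_openP.
have kj : trace_open O W `<=` V j by move=> x /hj /image_openP.
have WK : W `<=` image_open (trace_open O W) by rewrite trace_openK.
by rewrite -(res_comp (image_openS ki) WK) -(res_comp (image_openS kj) WK) (sE _ _ _ ki kj).
Qed.

Definition open_subspace (X : ringed_space) (O : opens X) : ringed_space :=
  @RingedSpace (set_type O) (fun W => sec (image_open W))
    (fun U V h => res (image_openS h))
    (fun U h s => res_id (image_openS h) s)
    (fun U V W hU hV h s =>
       res_comp (image_openS hU) (image_openS hV) (image_openS h) s)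
    (@open_subspace_glue X O).

Lemma is_unit_rmorph (A B : comPzRingType) (g : {rmorphism A -> B}) (x : A) :
  is_unit x -> is_unit (g x).
Proof. by case=> y xy; exists (g y); rewrite -rmorphM xy rmorph1. Qed.

Lemma is_unitM (A : comPzRingType) (x y : A) :
  is_unit (x * y) <-> is_unit x /\ is_unit y.
Proof.
split => [[z xyz]|[[u xu] [v yv]]].
  by split; [exists (y * z); rewrite mulrA|exists (x * z); rewrite mulrCA mulrA].
by exists (u * v); rewrite mulrACA xu yv mulr1.
Qed.

Lemma is_unitX (A : comPzRingType) (x : A) n : is_unit x -> is_unit (x ^+ n).
Proof. by case=> y xy; exists (y ^+ n); rewrite -exprMn xy expr1n. Qed.

Lemma open_subspace_unit_at (X : ringed_space) (O : opens X)
    (x : set_type O) (U : opens (set_type O)) (s : sec (image_open U)) :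
  @unit_at (open_subspace O) x U s <-> @unit_at X (val x) (image_open U) s.
Proof.
split => [[V [h [Vx us]]]|[V [h [Vx us]]]].
  by exists (image_open V), (image_openS h); split => //; apply/image_openP.
have VO : V `<=` O by move=> y /h /image_open_sub.
have hV : trace_open O V `<=` U by move=> y /h /image_openP.
have KV : image_open (trace_open O V) `<=` V by rewrite trace_openK.
exists (trace_open O V), hV; split => //=.
by rewrite -(res_comp h KV); exact: is_unit_rmorph.
Qed.

Lemma open_subspace_local (X : ringed_space) (O : opens X) :
  local_stalks X -> local_stalks (open_subspace O).
Proof.
move=> Xloc x U /image_openP Ux; have [X0 XD] := Xloc _ _ Ux.
split => [/open_subspace_unit_at //|s t /open_subspace_unit_at /XD].
by case=> us; [left|right]; apply/open_subspace_unit_at.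
Qed.

Lemma spec_openE (A : comPzRingType) : @open (spec A) = @zariski_open A.
Proof. by []. Qed.

Definition spec_map (A B : comPzRingType) (g : {rmorphism A -> B})
  (q : spec B) : spec A.
Proof.
exists (g @^-1` q) => /=; first by rewrite rmorph0; exact: pset0.
- by move=> x y qx qy; rewrite rmorphD; exact: psetD.
- by move=> a x qx; rewrite rmorphM; exact: psetMl.
- by rewrite rmorph1; exact: pset1.
- by move=> x y; rewrite rmorphM; exact: psetM.
Defined.

Lemma pset_unitM (A : comPzRingType) (p : spec A) (x u : A) :
  is_unit u -> p (x * u) <-> p x.
Proof.
case=> v uv; split => px; last by rewrite mulrC; exact: psetMl.
by rewrite -[x]mulr1 -uv mulrA mulrC; exact: psetMl.
Qed.

Lemma basic_openX (A : comPzRingType) (p : spec A) (f : A) n :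
  basic_open f p -> basic_open (f ^+ n) p.
Proof.
move=> pf; elim: n => [|n ih]; first by rewrite expr0; exact: pset1.
by rewrite exprS basic_openM.
Qed.

Lemma mulrAC_unit_eq0 (A : comPzRingType) (x u : A) :
  is_unit u -> x * u = 0 -> x = 0.
Proof. by case=> v uv xu; rewrite -[x]mulr1 -uv mulrA xu mul0r. Qed.

Lemma spec_localization (A B : comPzRingType) (f : A) (g : {rmorphism A -> B}) :
  is_localization f g ->
  [/\ injective (spec_map g),
      range (spec_map g) = basic_open f
    & forall b, exists2 a, spec_map g @` basic_open b = basic_open (f * a)
        & exists2 u, is_unit u & b * u = g a].
Proof.
case=> uf surj ker.
have ufn n : is_unit (g f ^+ n) by exact: is_unitX.
have inj : injective (spec_map g).
  move=> p q /(congr1 (@pset A)) pq; apply: spec_eq => b.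
  have [n [a ba]] := surj b.
  rewrite -(pset_unitM p b (ufn n)) -(pset_unitM q b (ufn n)) ba.
  by rewrite -[p (g a)]/((g @^-1` p) a) -[q (g a)]/((g @^-1` q) a) [g @^-1` p]pq.
have rng : range (spec_map g) = basic_open f.
  apply/seteqP; split => [_ [q _ <-] /= qf|p pf].
    by apply: (@pset1 _ q); rewrite -(pset_unitM q 1 uf) mul1r.
  have pfn n : ~ p (f ^+ n) by exact: basic_openX.
  pose Q b := exists2 a, p a & exists n, b * g f ^+ n = g a.
  have gP c d : g c = g d -> p c <-> p d.
    move=> /eqP; rewrite -subr_eq0 -rmorphB => /eqP /ker[n fcd].
    have : p (c - d).
      suff /psetM[/pfn|//] : p (f ^+ n * (c - d)) by [].
      by rewrite fcd; exact: pset0.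
    move=> pcd; have pdc : p (d - c) by rewrite -opprB -mulN1r; exact: psetMl.
    by split => ph; [rewrite -(subrK c d)|rewrite -(subrK d c)]; exact: psetD.
  have QE b n a : b * g f ^+ n = g a -> Q b <-> p a.
    move=> ba; split => [[a' pa' [n' ba']]|pa]; last by exists a => //; exists n.
    have /psetM[//|/pfn//] : p (a * f ^+ n').
    apply/(gP _ (f ^+ n * a')); last exact: psetMl.
    by rewrite !rmorphM !rmorphXn -ba -ba' mulrAC mulrC.
  have Qg a : Q (g a) <-> p a by apply: (QE _ 0%N); rewrite expr0 mulr1.
  unshelve eexists (@PrimeIdeal B Q _ _ _ _ _) => //.
  - by rewrite -(rmorph0 g); apply/Qg; exact: pset0.
  - move=> x y [a pa [n xa]] [b pb [m yb]].
    exists (a * f ^+ m + b * f ^+ n).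
      by apply: psetD; rewrite mulrC; exact: psetMl.
    exists (n + m)%N; rewrite rmorphD !rmorphM !rmorphXn -xa -yb mulrDl exprD.
    by rewrite mulrA; congr (_ + _); rewrite -mulrA [_ ^+ m * _]mulrC.
  - move=> x y [b pb [m yb]]; have [n [a xa]] := surj x.
    exists (a * b); first exact: psetMl.
    by exists (n + m)%N; rewrite rmorphM -xa -yb exprD mulrACA.
  - by rewrite -(rmorph1 g) => /Qg; exact: pset1.
  - move=> x y; have [n [a xa]] := surj x; have [m [b yb]] := surj y.
    have xyab : x * y * g f ^+ (n + m) = g (a * b).
      by rewrite rmorphM -xa -yb exprD mulrACA.
    move=> /(QE _ _ _ xyab) /psetM[pa|pb].
      by left; apply/(QE _ _ _ xa).
    by right; apply/(QE _ _ _ yb).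
  - by apply: spec_eq => a; exact: Qg.
split=> // b; have [n [a ba]] := surj b; exists a; last by exists (g f ^+ n).
rewrite basic_openM -rng; apply/seteqP; split.
  move=> _ [q qb <-]; split; first by exists q.
  by move=> /=; rewrite /basic_open /= -ba => /pset_unitM qb'; apply/qb/qb'.
move=> p [[q _ <-]] /= qa; exists q => //.
by move=> qb; apply: qa; rewrite /basic_open /= -ba; apply/pset_unitM.
Qed.

Lemma spec_localization_open (A B : comPzRingType) (f : A)
    (g : {rmorphism A -> B}) : is_localization f g ->
  forall D : set (spec B), open D <-> open (spec_map g @` D).
Proof.
move=> /spec_localization[inj rng bas] D; rewrite !spec_openE.
split => [[E ->]|[E DE]].
  rewrite image_bigcup -spec_openE; apply: bigcup_open => b _.
  by rewrite spec_openE; have [a -> _] := bas b; exists [set f * a]; rewrite bigcup_set1.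
exists (g @` E); apply/seteqP; split => q.
  move=> Dq; have : (spec_map g @` D) (spec_map g q) by exists q.
  by rewrite DE => -[e Ee qe]; exists (g e) => //; exists e.
move=> [_ [e Ee <-] qe]; have : (spec_map g @` D) (spec_map g q).
  by rewrite DE; exists e.
by move=> [q' Dq' /inj <-].
Qed.

Lemma is_localization_trans (A B C : comPzRingType) (f : A)
    (g : {rmorphism A -> B}) (b : B) (a : A) (u : B) (r : {rmorphism B -> C}) :
  is_localization f g -> is_unit u -> b * u = g a ->
  is_localization (f * a) (r \o g) -> is_localization b r.
Proof.
move=> [uf surj ker] uu ba [/= uC surjC kerC].
have rE : r (g (f * a)) = r b * r (u * g f).
  by rewrite rmorphM -ba -rmorphM mulrC -mulrA.
have [ub [w uw]] : is_unit (r b) /\ is_unit (u * g f).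
  split; last exact/is_unitM.
  by move: uC; rewrite rE => /is_unitM[].
split=> // [c|b' rb'].
  have [n [a' ca']] := surjC c; exists n, (g a' * w ^+ n).
  rewrite rmorphM -ca' rE rmorphXn exprMn -!mulrA; congr (_ * _).
  by rewrite -[LHS]mulr1; congr (_ * _); rewrite -exprMn -rmorphM uw rmorph1 expr1n.
have [n [a' ba']] := surj b'.
have /kerC[m] : r (g a') = 0 by rewrite -ba' rmorphM rb' mul0r.
move=> /(congr1 g); rewrite rmorph0 rmorphM rmorphXn -ba' => h; exists m.
apply: (mulrAC_unit_eq0 (is_unitX n uf)).
apply: (mulrAC_unit_eq0 (is_unitX m (proj2 (is_unitM u (g f)) (conj uu uf)))).
rewrite -h rmorphM -ba [g f * _]mulrC -[b * u * _]mulrA [(b * _) ^+ m]exprMn.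
by rewrite -[b ^+ m * b' * _]mulrA mulrAC.
Qed.

Lemma open_subspace_affine (X : ringed_space) (O : opens X) :
  (forall x : X, exists2 W : opens X, W x & is_affine_open W) ->
  forall x : open_subspace O,
    exists2 W : opens (open_subspace O), W x & is_affine_open W.
Proof.
move=> Xaff x; have [W Wx [A [j [a [jI jW jO jloc]]]]] := Xaff (val x).
have [p _ jp] : range j (val x) by rewrite jW.
have : open (j @^-1` O).
  apply/jO; rewrite (_ : _ @` _ = O `&` W); last first.
    rewrite -jW; apply/seteqP; split => [_ [q Oq <-]|t [Ot [q _ jq]]].
      by split=> //; exists q.
    by exists q => //; rewrite /preimage /= jq.
  by apply: openI; exact: open_oset.
rewrite spec_openE => -[E EO].
have [f Ef pf] : (\bigcup_(f in E) basic_open f) p.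
  by rewrite -EO /= jp; exact: set_valP.
have fO : j @` basic_open f `<=` O.
  by move=> _ [q qf <-]; rewrite -[_ _]/((j @^-1` O) q) EO; exists f.
have jf : open (j @` basic_open f).
  by apply/jO; rewrite spec_openE; exists [set f]; rewrite bigcup_set1.
pose V := trace_open O (Opens jf); exists V; first by exists p.
have VE : image_open V = j @` basic_open f :> set X by rewrite trace_openK.
have VW : image_open V `<=` W by rewrite VE -jW => _ [q _ <-]; exists q.
pose g : {rmorphism A -> sec (image_open V)} := res VW \o a.
have gloc : is_localization f g by exact: jloc.
have [gI gf gbas] := spec_localization gloc.
have jgO q : O (j (spec_map g q)).
  by apply: fO; exists (spec_map g q) => //; rewrite -gf; exists q.
pose j' q : open_subspace O := SigSub (mem_set (jgO q)).
have j'E (D : set (spec (sec (image_open V)))) :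
    val @` (j' @` D) = j @` (spec_map g @` D).
  by rewrite !image_comp.
exists (sec (image_open V)), j', idfun; split.
- by move=> q q' /(congr1 val) /= /jI /gI.
- apply/seteqP; split => [_ [q _ <-]|y].
    by exists (spec_map g q) => //; rewrite -gf; exists q.
  move=> -[q]; rewrite -gf => -[r _ <-] jy.
  by exists r => //; apply: val_inj.
- move=> D; rewrite (spec_localization_open gloc) jO -j'E; split.
    move=> oD; have := open_subset_preimage O (Opens oD).
    congr open; apply/seteqP; split => [y [z ? /val_inj <-]//|y ? /=].
    by exists y.
  by exact: open_subset_image.
- move=> b B h BE /=.
  have BX : image_open B = j @` (spec_map g @` basic_open b) :> set X.
    by rewrite -j'E -BE.
  have [c bc [u uu bu]] := gbas b.
  apply: (is_localization_trans gloc uu bu).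
  have BW : image_open B `<=` W by move=> y /(image_openS h) /VW.
  have := jloc (f * c) (image_open B) BW; rewrite -bc -BX => /(_ erefl).
  congr is_localization; apply/funext => s /=.
  by rewrite (res_comp VW (image_openS h) BW).
Qed.

Definition open_subscheme (X : scheme) (U : opens X) : scheme :=
  @Scheme (open_subspace U) (open_subspace_local (@scheme_local X))
    (open_subspace_affine (@scheme_affine X)).

Definition preimage_open (X Y : topologicalType) (f : X -> Y)
    (fc : continuous f) (V : opens Y) : opens X :=
  Opens ((continuousP _).1 fc V (open_oset V)).

Record hom (X Y : scheme) := Hom {
  hom_fun :> X -> Y;
  hom_continuous : continuous hom_fun;
  sharp : forall V : opens Y,
    {rmorphism sec V -> sec (preimage_open hom_continuous V)};
  sharp_res : forall (U V : opens Y) (h : V `<=` U)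
    (h' : preimage_open hom_continuous V `<=` preimage_open hom_continuous U)
    (s : sec U), res h' (sharp U s) = sharp V (res h s);
  (* the induced map of stalks O_{Y, f x} -> O_{X, x} is local *)
  sharp_local : forall (x : X) (V : opens Y) (s : sec V), V (hom_fun x) ->
    unit_at x (sharp V s) -> unit_at (hom_fun x) s }.

Definition hom_preimage (X Y : scheme) (f : hom X Y) (V : opens Y) : opens X :=
  preimage_open (@hom_continuous _ _ f) V.

Lemma rmorphism_ext (A B : pzRingType) (f g : {rmorphism A -> B}) :
  (forall x, f x = g x) -> f = g.
Proof.
move=> fg; have {fg} : f = g :> (A -> B) by exact/funext.
case: f g => [f cf] [g cg] /= fg; rewrite fg in cf *; congr GRing.RMorphism.Pack.
case: cf cg => [[a] [b]] [[a'] [b']].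
by rewrite (Prop_irrelevance a a') (Prop_irrelevance b b').
Qed.

Lemma hom_ext (X Y : scheme) (f g : hom X Y) :
  (forall x, f x = g x) ->
  (forall (V : opens Y) (h : hom_preimage g V `<=` hom_preimage f V) s,
    res h (sharp f V s) = sharp g V s) ->
  f = g.
Proof.
case: f g => [f fc fs fr fl] [g gc gs gr gl] /= /funext fg; case: _ / fg in gc gs gr gl *.
rewrite /hom_preimage /=; rewrite (Prop_irrelevance gc fc) in gs gr gl *.
move=> fgs; have fsE : fs = gs.
  apply: functional_extensionality_dep => V; apply: rmorphism_ext => s.
  have h : preimage_open fc V `<=` preimage_open fc V by [].
  exact: etrans (esym (res_id h _)) (fgs V h s).
by case: _ / fsE in gr gl fgs *; congr Hom; exact: Prop_irrelevance.
Qed.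

Lemma unit_at_res (X : ringed_space) (x : X) (U V : opens X) (h : V `<=` U)
  (s : sec U) : V x -> unit_at x (res h s) <-> unit_at x s.
Proof.
move=> Vx; split => [[W [k [Wx us]]]|[W [k [Wx us]]]].
  have kh : W `<=` U by move=> y /k /h.
  by exists W, kh; split => //; rewrite -(res_comp h k kh).
have oWV : open (W `&` V) by apply: openI; exact: open_oset.
pose WV := Opens oWV.
have k1 : WV `<=` W by move=> y [].
have k2 : WV `<=` V by move=> y [].
have k3 : WV `<=` U by move=> y [/k].
exists WV, k2; split=> //; rewrite (res_comp h k2 k3) -(res_comp k k1 k3).
exact: is_unit_rmorph.
Qed.

Lemma comp_continuous (X Y Z : scheme) (g : hom Y Z) (f : hom X Y) :
  continuous (g \o f).
Proof. by move=> x; apply: continuous_comp; exact: hom_continuous. Qed.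
Arguments comp_continuous {X Y Z} g f.

Lemma comp_preimage (X Y Z : scheme) (g : hom Y Z) (f : hom X Y) (W : opens Z) :
  preimage_open (comp_continuous g f) W `<=` hom_preimage f (hom_preimage g W).
Proof. by []. Qed.

(* The restrictions [res] below are along equalities of opens: the two sides   *)
(* have the same points but are not convertible.                               *)
Definition comp_sharp (X Y Z : scheme) (g : hom Y Z) (f : hom X Y) (W : opens Z) :
    {rmorphism sec W -> sec (preimage_open (comp_continuous g f) W)} :=
  res (@comp_preimage _ _ _ g f W) \o sharp f (hom_preimage g W) \o sharp g W.
Arguments comp_sharp {X Y Z} g f W.

Lemma comp_sharp_res (X Y Z : scheme) (g : hom Y Z) (f : hom X Y)
    (U V : opens Z) (h : V `<=` U)
    (h' : preimage_open (comp_continuous g f) V `<=`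
          preimage_open (comp_continuous g f) U) (s : sec U) :
  res h' (comp_sharp g f U s) = comp_sharp g f V (res h s).
Proof.
have hg : hom_preimage g V `<=` hom_preimage g U by move=> y /h.
have hf : hom_preimage f (hom_preimage g V) `<=`
          hom_preimage f (hom_preimage g U) by move=> x /hg.
have k : preimage_open (comp_continuous g f) V `<=`
         hom_preimage f (hom_preimage g U) by [].
rewrite /= -(sharp_res h hg) -(sharp_res hg hf).
by rewrite (res_comp _ _ k) (res_comp _ _ k).
Qed.

Lemma comp_sharp_local (X Y Z : scheme) (g : hom Y Z) (f : hom X Y) (x : X)
    (V : opens Z) (s : sec V) : V (g (f x)) ->
  unit_at x (comp_sharp g f V s) -> unit_at (g (f x)) s.
Proof.
move=> Vx /unit_at_res => /(_ Vx) u.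
by do 2 apply: sharp_local => //.
Qed.

Definition hom_comp (X Y Z : scheme) (g : hom Y Z) (f : hom X Y) : hom X Z :=
  Hom (@comp_sharp_res X Y Z g f) (@comp_sharp_local X Y Z g f).

Lemma val_continuous (X : scheme) (U : opens X) :
  continuous (val : open_subscheme U -> X).
Proof. by apply/continuousP => B oB; exists B. Qed.
Arguments val_continuous {X} U.

Lemma val_preimage (X : scheme) (U V : opens X) :
  image_open (preimage_open (val_continuous U) V) `<=` V.
Proof. by move=> _ [x Vx <-]. Qed.

Definition val_sharp (X : scheme) (U V : opens X) :
    {rmorphism sec V ->
       @sec (open_subscheme U) (preimage_open (val_continuous U) V)} :=
  res (@val_preimage X U V).
Arguments val_sharp {X} U V.

Lemma val_sharp_res (X : scheme) (U V W : opens X) (h : W `<=` V)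
    (h' : preimage_open (val_continuous U) W `<=`
          preimage_open (val_continuous U) V) (s : sec V) :
  res h' (val_sharp U V s) = val_sharp U W (res h s).
Proof.
have k : image_open (preimage_open (val_continuous U) W) `<=` V.
  by move=> x /val_preimage /h.
by rewrite /val_sharp /= (res_comp _ _ k) (res_comp _ _ k).
Qed.

Lemma val_sharp_local (X : scheme) (U : opens X) (x : open_subscheme U)
    (V : opens X) (s : sec V) : V (val x) ->
  unit_at x (val_sharp U V s) -> unit_at (val x) s.
Proof.
by move=> Vx /open_subspace_unit_at /unit_at_res; apply; exists x.
Qed.

Definition open_incl (X : scheme) (U : opens X) : hom (open_subscheme U) X :=
  Hom (@val_sharp_res X U) (@val_sharp_local X U).

(* [f] with its codomain restricted to an open [V] containing its image *)
Definition corestrict (X Y : scheme) (f : hom X Y) (V : opens Y)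
    (fV : forall x, V (f x)) (x : X) : open_subscheme V :=
  SigSub (mem_set (fV x)).

Lemma corestrict_continuous (X Y : scheme) (f : hom X Y) (V : opens Y)
  (fV : forall x, V (f x)) : continuous (corestrict fV).
Proof.
apply/continuousP => W oW.
have := open_oset (hom_preimage f (image_open (Opens oW))).
congr open; apply/seteqP; split => [x [y Wy yfx]|x Wx].
  rewrite /preimage /= (_ : corestrict _ _ = y) //; exact: val_inj.
by exists (corestrict fV x).
Qed.
Arguments corestrict_continuous {X Y f V} fV.

Lemma corestrict_preimage (X Y : scheme) (f : hom X Y) (V : opens Y)
    (fV : forall x, V (f x)) (W : opens (open_subscheme V)) :
  preimage_open (corestrict_continuous fV) W `<=` hom_preimage f (image_open W).
Proof. by move=> x Wx; exists (corestrict fV x). Qed.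

Definition corestrict_sharp (X Y : scheme) (f : hom X Y) (V : opens Y)
    (fV : forall x, V (f x)) (W : opens (open_subscheme V)) :
    {rmorphism @sec (open_subscheme V) W ->
       sec (preimage_open (corestrict_continuous fV) W)} :=
  res (@corestrict_preimage _ _ f V fV W) \o sharp f (image_open W).
Arguments corestrict_sharp {X Y f V} fV W.

Lemma corestrict_sharp_res (X Y : scheme) (f : hom X Y) (V : opens Y)
    (fV : forall x, V (f x)) (U W : opens (open_subscheme V)) (h : W `<=` U)
    (h' : preimage_open (corestrict_continuous fV) W `<=`
          preimage_open (corestrict_continuous fV) U)
    (s : @sec (open_subscheme V) U) :
  res h' (corestrict_sharp fV U s) = corestrict_sharp fV W (res h s).
Proof.
have hf : hom_preimage f (image_open W) `<=` hom_preimage f (image_open U).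
  by move=> x /(image_openS h).
have k : preimage_open (corestrict_continuous fV) W `<=`
         hom_preimage f (image_open U) by move=> x /corestrict_preimage /hf.
rewrite /= -(sharp_res (image_openS h) hf).
by rewrite (res_comp _ _ k) (res_comp _ _ k).
Qed.

Lemma corestrict_sharp_local (X Y : scheme) (f : hom X Y) (V : opens Y)
    (fV : forall x, V (f x)) (x : X) (W : opens (open_subscheme V))
    (s : @sec (open_subscheme V) W) : W (corestrict fV x) ->
  unit_at x (corestrict_sharp fV W s) -> unit_at (corestrict fV x) s.
Proof.
move=> Wx /unit_at_res => /(_ Wx) u.
apply/open_subspace_unit_at; apply: sharp_local u.
exact: (@corestrict_preimage _ _ f V fV W).
Qed.

Definition hom_corestrict (X Y : scheme) (f : hom X Y) (V : opens Y)
    (fV : forall x, V (f x)) : hom X (open_subscheme V) :=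
  Hom (@corestrict_sharp_res X Y f V fV) (@corestrict_sharp_local X Y f V fV).

Definition open_incl_le (X : scheme) (U V : opens X) (h : U `<=` V) :
    hom (open_subscheme U) (open_subscheme V) :=
  @hom_corestrict _ _ (open_incl U) V (fun x => h _ (set_valP x)).

Lemma hom_compA (X Y Z T : scheme) (h : hom Z T) (g : hom Y Z) (f : hom X Y) :
  hom_comp h (hom_comp g f) = hom_comp (hom_comp h g) f.
Proof.
apply: hom_ext => // V k s /=.
set t := sharp g _ _.
have hk : hom_preimage f (hom_preimage (hom_comp h g) V) `<=`
          hom_preimage f (hom_preimage g (hom_preimage h V)) by [].
have k' : hom_preimage (hom_comp (hom_comp h g) f) V `<=`
          hom_preimage f (hom_preimage g (hom_preimage h V)) by [].
have k1 : hom_preimage (hom_comp h (hom_comp g f)) V `<=`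
          hom_preimage f (hom_preimage g (hom_preimage h V)) by [].
by rewrite -(sharp_res _ hk) (res_comp _ _ k1) !(res_comp _ _ k').
Qed.

Lemma open_incl_corestrict (X Y : scheme) (f : hom X Y) (V : opens Y)
    (fV : forall x, V (f x)) : hom_comp (open_incl V) (hom_corestrict fV) = f.
Proof.
apply: hom_ext => // W k s.
rewrite /= /val_sharp.
pose sub := @val_preimage _ V W.
have hf : hom_preimage f (image_open (hom_preimage (open_incl V) W)) `<=`
          hom_preimage f W by move=> x /sub.
have k1 : hom_preimage (hom_comp (open_incl V) (hom_corestrict fV)) W `<=`
          hom_preimage f W by [].
have k2 : hom_preimage (hom_corestrict fV) (hom_preimage (open_incl V) W) `<=`
          hom_preimage f W by [].
rewrite -(sharp_res sub hf) (res_comp _ _ k2) (res_comp _ _ k1).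
by rewrite (res_comp _ _ (fun x p => p)) res_id.
Qed.

Record scheme_over (S : scheme) := SchemeOver {
  total :> scheme;
  structure : hom total S }.

Record hom_over (S : scheme) (X Y : scheme_over S) := HomOver {
  hom_of :> hom X Y;
  hom_overE : hom_comp (structure Y) hom_of = structure X }.

Definition hom_over_comp (S : scheme) (X Y Z : scheme_over S)
    (g : hom_over Y Z) (f : hom_over X Y) : hom_over X Z.
Proof.
by exists (hom_comp g f); rewrite hom_compA !hom_overE.
Defined.

Definition open_over (S : scheme) (X : scheme_over S) (U : opens X) :
  scheme_over S := SchemeOver (hom_comp (structure X) (open_incl U)).

Definition open_incl_over (S : scheme) (X : scheme_over S) (U : opens X) :
  hom_over (open_over U) X := @HomOver _ (open_over U) X (open_incl U) erefl.

Definition hom_over_corestrict (S : scheme) (X Y : scheme_over S)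
    (f : hom_over X Y) (V : opens Y) (fV : forall x, V (f x)) :
    hom_over X (open_over V).
Proof.
exists (hom_corestrict fV).
by rewrite -hom_compA open_incl_corestrict hom_overE.
Defined.

(* The square  X' --q--> X  is cartesian in the category of schemes.
               |p'       |p
               S' --g--> S                                                     *)
Definition is_pullback (X S S' X' : scheme) (p : hom X S) (g : hom S' S)
    (q : hom X' X) (p' : hom X' S') : Prop :=
  hom_comp p q = hom_comp g p' /\
  forall (T : scheme) (a : hom T X) (b : hom T S'),
    hom_comp p a = hom_comp g b ->
    exists! u : hom T X', hom_comp q u = a /\ hom_comp p' u = b.

Definition schematically_dominant (X Y : scheme) (f : hom X Y) : Prop :=
  forall V : opens Y, injective (sharp f V).

(* [f'] is the base change of [f] along [g : S' -> S].                         *)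
Definition S_dominant (S : scheme) (X Y : scheme_over S) (f : hom_over X Y) :
    Prop :=
  forall (S' : scheme) (g : hom S' S) (X' Y' : scheme)
    (qX : hom X' X) (pX : hom X' S') (qY : hom Y' Y) (pY : hom Y' S')
    (f' : hom X' Y'),
    is_pullback (structure X) g qX pX ->
    is_pullback (structure Y) g qY pY ->
    hom_comp qY f' = hom_comp f qX -> hom_comp pY f' = pX ->
    schematically_dominant f'.

Definition S_dense (S : scheme) (X : scheme_over S) (U : opens X) : Prop :=
  S_dominant (open_incl_over U).

Record rep (S : scheme) (X Y : scheme_over S) := Rep {
  dom : opens X;
  dom_dense : S_dense dom;
  rep_hom :> hom_over (open_over dom) Y }.

Definition rep_equiv (S : scheme) (X Y : scheme_over S) (r r' : rep X Y) : Prop :=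
  exists (U : opens X) (h : U `<=` dom r) (h' : U `<=` dom r'),
    S_dense U /\
    hom_comp r (open_incl_le h) = hom_comp r' (open_incl_le h').

Definition rep_class (S : scheme) (X Y : scheme_over S) (r : rep X Y) :
  set (rep X Y) := [set r' | rep_equiv r r'].

Record rational (S : scheme) (X Y : scheme_over S) := Rational {
  representatives :> set (rep X Y);
  representativesP : exists r, representatives = rep_class r }.

Definition rational_of (S : scheme) (X Y : scheme_over S) (r : rep X Y) :
  rational X Y := Rational (ex_intro _ r erefl).

Definition diffuse (S : scheme) (X Y : scheme_over S) (f : hom_over X Y) : Prop :=
  forall V : opens Y, S_dense V -> S_dense (hom_preimage f V : opens X).

Definition rational_diffuse (S : scheme) (X Y : scheme_over S)
    (phi : rational X Y) : Prop :=
  exists2 r : rep X Y, phi r & diffuse r.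

Definition composable (S : scheme) (X Y Z : scheme_over S)
    (r : rep X Y) (q : rep Y Z) : Prop := forall x, dom q (r x).

Definition rep_comp (S : scheme) (X Y Z : scheme_over S)
    (r : rep X Y) (q : rep Y Z) (h : composable r q) : rep X Z :=
  Rep (@dom_dense _ _ _ r) (hom_over_comp q (hom_over_corestrict h)).

(* Main.v *)
From mathcomp Require Import all_boot all_algebra.
From mathcomp Require Import all_classical topology.
Require Import Defs.

Set Implicit Arguments.
Unset Strict Implicit.
Unset Printing Implicit Defensive.
Local Open Scope classical_set_scope.

(** S-density of an open U of X turns into a condition on restriction maps: U is
    S-dense exactly when, for every base change X' of X with projection q, all
    restrictions of sections from V to V `&` q^-1 U are injective ([S_denseP]).
    The point is that q^-1 U, as an open subscheme of X', is a base change of U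
    ([is_pullback_open]). Composing injections then shows that S-dense opens are
    stable under finite intersections ([S_denseI]) and that an S-dense open of an
    S-dense open is S-dense ([S_dense_trans]). Hence equivalence of
    representatives is transitive, and if r is a diffuse representative then
    r^-1 V is an S-dense open of X for every S-dense open V of Y
    ([diffuse_preimage]).

    For existence, restrict a diffuse representative r0 of phi to the preimage
    under r0 of the domain of an arbitrary representative q of psi.

    For independence, let r and r' be representatives of phi, and q and q' of
    psi. The representatives r0, r and r' coincide on S-dense opens of X, and q
    and q' coincide on an S-dense open V of Y. On the intersection of those opens
    of X with r0^-1 V, which is S-dense, r and r' are the same morphism and it
    takes values in V, where q and q' are the same, so the two composites agree
    there ([rep_comp_equiv]). The composites pass through corestrictions to
    different opens of Y, and these are compared by means of the fact that open
    inclusions are monomorphisms ([open_incl_mono]). *)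

(** * Morphisms into and out of open subschemes *)

(** The sections of an open subscheme over W are by definition those of Y over
    the image of W, so the comorphism of [a] can be read off from that of its
    composite with the inclusion. *)
Lemma hom_corestrict_unique (X Y : scheme) (f : hom X Y) (V : opens Y)
    (fV : forall x, V (f x)) (a : hom X (open_subscheme V)) :
  hom_comp (open_incl V) a = f -> a = hom_corestrict fV.
Proof.
move=> E; case: _ / E in fV *.
apply: hom_ext => [x|W k s /=]; first exact: val_inj.
have WK : hom_preimage (open_incl V) (image_open W) `<=` W.
  by move=> x /image_openP.
have h1 : hom_preimage a (hom_preimage (open_incl V) (image_open W)) `<=`
          hom_preimage a W by move=> x /WK.
have k1 : hom_preimage (hom_comp (open_incl V) a) (image_open W) `<=`
          hom_preimage a W by move=> x /WK.
(* Over [image_open W] the comorphism of the inclusion is the restriction along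
   an equality of opens, hence a restriction map of the open subscheme. *)
have -> : val_sharp V (image_open W) s = @res (open_subscheme V) _ _ WK s.
  rewrite /val_sharp /=.
  have valE := Prop_irrelevance (image_openS WK)
    (@val_preimage Y V (image_open W)).
  by rewrite valE.
rewrite -(sharp_res WK h1).
by rewrite (res_comp _ _ k1) (res_comp _ _ k).
Qed.

Lemma open_incl_mono (X Y : scheme) (V : opens Y)
    (a b : hom X (open_subscheme V)) :
  hom_comp (open_incl V) a = hom_comp (open_incl V) b -> a = b.
Proof.
move=> ab; have bV x : V (hom_comp (open_incl V) b x) by exact: set_valP.
by rewrite (hom_corestrict_unique bV ab) [RHS](hom_corestrict_unique bV erefl).
Qed.

Lemma open_incl_le_comp (X : scheme) (U V W : opens X) (h1 : U `<=` V)
    (h2 : V `<=` W) (h : U `<=` W) :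
  hom_comp (open_incl_le h2) (open_incl_le h1) = open_incl_le h.
Proof. by apply: open_incl_mono; rewrite hom_compA !open_incl_corestrict. Qed.

(** * Base change of an open subscheme *)

Definition restrict_hom (X Y : scheme) (f : hom X Y) (V : opens Y) :
    hom (open_subscheme (hom_preimage f V)) (open_subscheme V) :=
  @hom_corestrict _ _ (hom_comp f (open_incl (hom_preimage f V))) V
    (fun x => set_valP x).

(** A cone over U is a cone over X, hence factors through X'; its points are
    sent into U by q, so the factorization lands in q^-1 U. *)
Lemma is_pullback_open (S S' X X' : scheme) (p : hom X S) (g : hom S' S)
    (q : hom X' X) (p' : hom X' S') (U : opens X) :
  is_pullback p g q p' ->
  is_pullback (hom_comp p (open_incl U)) g (restrict_hom q U)
    (hom_comp p' (open_incl (hom_preimage q U))).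
Proof.
case=> sq univ; split.
  by rewrite -hom_compA open_incl_corestrict hom_compA sq -hom_compA.
move=> T a b; rewrite -hom_compA => /univ[u [[qu pu] uniq]].
have uU x : hom_preimage q U (u x).
  have -> : hom_preimage q U (u x) = U (hom_comp q u x) by [].
  by rewrite qu; exact: set_valP.
exists (hom_corestrict uU); split; first split.
- apply: open_incl_mono.
  by rewrite hom_compA open_incl_corestrict -hom_compA open_incl_corestrict.
- by rewrite -hom_compA open_incl_corestrict.
- move=> v [av bv]; apply: esym; apply: hom_corestrict_unique.
  apply: esym; apply: uniq; split; last by rewrite hom_compA.
  by rewrite -av !hom_compA open_incl_corestrict.
Qed.

(** * Density and restriction of sections *)

Definition opensI (X : topologicalType) (U V : opens X) : opens X :=
  Opens (openI (open_oset U) (open_oset V)).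

(** The main case is W = V `&` U, which gives the other ones. Quantifying over W
    avoids casts between opens that have the same points but are not
    convertible. *)
Definition dense_sections (X : ringed_space) (U : opens X) : Prop :=
  forall (V W : opens X) (h : W `<=` V), V `&` U `<=` W -> injective (res h).

Lemma schematically_dominant_incl (X : scheme) (U : opens X) :
  schematically_dominant (open_incl U) <-> dense_sections U.
Proof.
split=> [D V W h UW s t E|D V]; last first.
  by apply: D => x [Vx Ux]; exists (SigSub (mem_set Ux)).
have k : image_open (hom_preimage (open_incl U) V) `<=` W.
  by move=> x kx; apply: UW; split; [case: kx => y Vy <-|exact: image_open_sub kx].
by apply: (D V); rewrite /= /val_sharp -!(res_comp h k) E.
Qed.

Lemma schematically_dominant_factor (X Y Z : scheme) (g : hom Y Z)
    (f : hom X Y) :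
  schematically_dominant (hom_comp g f) -> schematically_dominant g.
Proof. by move=> D V s t E; apply: (D V); rewrite /= E. Qed.

(** Restrict from A to A `&` U, then to A `&` U `&` V; this factors through W. *)
Lemma dense_sectionsI (X : ringed_space) (U V : opens X) :
  dense_sections U -> dense_sections V -> dense_sections (opensI U V).
Proof.
move=> dU dV A W h UVW s t E.
have h1 : opensI A U `<=` A by move=> x [].
have h2 : opensI (opensI A U) V `<=` opensI A U by move=> x [].
have h3 : opensI (opensI A U) V `<=` W by move=> x [[Ax Ux] Vx]; exact: UVW.
have h4 : opensI (opensI A U) V `<=` A by move=> x [[]].
apply: (dU _ _ h1) => //; apply: (dV _ _ h2) => //.
by rewrite !(res_comp _ _ h4) -!(res_comp h h3) E.
Qed.

(** Restrict from A to A `&` U, then to its trace on W. *)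
Lemma dense_sections_trans (X : ringed_space) (U : opens X)
    (W : opens (open_subspace U)) (B : opens X) : image_open W `<=` B ->
  dense_sections U -> dense_sections W -> dense_sections B.
Proof.
move=> WB dU dW A C h BC s t E.
have h1 : image_open (trace_open U A) `<=` A by move=> _ [x Ax <-].
have h2 : opensI (trace_open U A) W `<=` trace_open U A by move=> x [].
have h3 : image_open (opensI (trace_open U A) W) `<=` C.
  by move=> _ [x [Ax Wx] <-]; apply: BC; split => //; apply: WB; exists x.
have h4 : image_open (opensI (trace_open U A) W) `<=` A by move=> x /h3 /h.
apply: (dU _ _ h1) => [x [Ax Ux]|]; first by exists (SigSub (mem_set Ux)).
apply: (dW _ _ h2) => //=.
by rewrite !(res_comp _ _ h4) -!(res_comp h h3) E.
Qed.

(** For the direct implication take q^-1 U itself as the base change of U. For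
    the converse, let U' be any base change of U and f' : U' -> X' the induced
    morphism. The inclusion of q^-1 U into X' factors through f', by the
    universal property of U', so the comorphism of f' is the first factor of an
    injective map. *)
Lemma S_denseP (S : scheme) (X : scheme_over S) (U : opens X) :
  S_dense U <->
  forall (S' X' : scheme) (g : hom S' S) (q : hom X' X) (p : hom X' S'),
    is_pullback (structure X) g q p -> dense_sections (hom_preimage q U).
Proof.
split=> [D S' X' g q p pb|D S' g U' X' qU pU q p f' pbU pb fq fp].
  apply/schematically_dominant_incl.
  apply: (D _ _ _ _ _ _ _ _ _ (is_pullback_open U pb) pb) => //.
  by rewrite [RHS]open_incl_corestrict.
have /schematically_dominant_incl dom_incl := D _ _ _ _ _ pb.
have [sq _] := is_pullback_open U pb.
have [e [[qe pe] _]] := pbU.2 _ _ _ sq.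
have cone : hom_comp (structure X) (hom_comp q (open_incl (hom_preimage q U))) =
            hom_comp g (hom_comp p (open_incl (hom_preimage q U))).
  by rewrite !hom_compA pb.1.
have [i [_ uniq]] := pb.2 _ _ _ cone.
have fe : hom_comp f' e = open_incl (hom_preimage q U).
  rewrite -(uniq (open_incl _)) //; apply: esym; apply: uniq; split.
    by rewrite hom_compA fq -hom_compA qe [LHS]open_incl_corestrict.
  by rewrite hom_compA fp.
by apply: (@schematically_dominant_factor _ _ _ f' e); rewrite fe.
Qed.

Lemma S_denseI (S : scheme) (X : scheme_over S) (U V : opens X) :
  S_dense U -> S_dense V -> S_dense (opensI U V).
Proof.
move=> /S_denseP dU /S_denseP dV; apply/S_denseP => S' X' g q p pb.
exact: dense_sectionsI (dU _ _ _ _ _ pb) (dV _ _ _ _ _ pb).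
Qed.

Lemma S_dense_trans (S : scheme) (X : scheme_over S) (U : opens X)
    (W : opens (open_over U)) :
  S_dense U -> S_dense W -> S_dense (image_open W : opens X).
Proof.
move=> /S_denseP dU /S_denseP dW; apply/S_denseP => S' X' g q p pb.
apply: (dense_sections_trans _ (dU _ _ _ _ _ pb)
          (dW _ _ _ _ _ (is_pullback_open U pb))) => _ [x Wx <-].
by exists (restrict_hom q U x).
Qed.

(** * Rational morphisms as equivalence classes *)

Lemma rep_equiv_refl (S : scheme) (X Y : scheme_over S) (r : rep X Y) :
  rep_equiv r r.
Proof.
exists (dom r), (fun x h => h), (fun x h => h).
by split => //; exact: dom_dense.
Qed.

Lemma rep_equiv_sym (S : scheme) (X Y : scheme_over S) (r r' : rep X Y) :
  rep_equiv r r' -> rep_equiv r' r.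
Proof. by move=> [U [h [h' [dU E]]]]; exists U, h', h. Qed.

Lemma rep_equiv_trans (S : scheme) (X Y : scheme_over S) (r r' r'' : rep X Y) :
  rep_equiv r r' -> rep_equiv r' r'' -> rep_equiv r r''.
Proof.
move=> [U [hU [hU' [dU EU]]]] [V [hV' [hV [dV EV]]]].
have kU : opensI U V `<=` U by move=> x [].
have kV : opensI U V `<=` V by move=> x [].
have h : opensI U V `<=` dom r by move=> x /kU /hU.
have h' : opensI U V `<=` dom r' by move=> x /kU /hU'.
have h'' : opensI U V `<=` dom r'' by move=> x /kV /hV.
exists (opensI U V), h, h''; split; first exact: S_denseI.
rewrite -(open_incl_le_comp kU hU) hom_compA EU -hom_compA.
rewrite (open_incl_le_comp kU hU' h') -(open_incl_le_comp kV hV' h').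
by rewrite hom_compA EV -hom_compA open_incl_le_comp.
Qed.

Lemma rational_rep (S : scheme) (X Y : scheme_over S) (phi : rational X Y) :
  exists r, phi r.
Proof.
by case: phi => R [r E] /=; exists r; rewrite E; exact: rep_equiv_refl.
Qed.

Lemma rational_equiv (S : scheme) (X Y : scheme_over S) (phi : rational X Y)
    (r r' : rep X Y) : phi r -> phi r' <-> rep_equiv r r'.
Proof.
case: phi => R [r0 E] /=; rewrite E => r0r; split => [r0r'|];
  last exact: rep_equiv_trans.
exact: rep_equiv_trans (rep_equiv_sym r0r) r0r'.
Qed.

Lemma rational_of_eq (S : scheme) (X Y : scheme_over S) (r r' : rep X Y) :
  rep_equiv r r' -> rational_of r = rational_of r'.
Proof.
move=> rr'; have E : rep_class r = rep_class r'.
  apply/seteqP; split=> t; apply: rep_equiv_trans => //.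
  exact: rep_equiv_sym.
rewrite /rational_of; move: (ex_intro _ _ _) (ex_intro _ _ _); rewrite E => a b.
by rewrite (Prop_irrelevance a b).
Qed.

(** * Composition with a diffuse representative *)

Definition rep_restrict (S : scheme) (X Y : scheme_over S) (r : rep X Y)
    (U : opens X) (dU : S_dense U) (h : U `<=` dom r) : rep X Y.
Proof.
exists U => //; exists (hom_comp r (open_incl_le h)).
by rewrite hom_compA hom_overE -hom_compA open_incl_corestrict.
Defined.

Lemma rep_restrict_equiv (S : scheme) (X Y : scheme_over S) (r : rep X Y)
    (U : opens X) (dU : S_dense U) (h : U `<=` dom r) :
  rep_equiv r (rep_restrict dU h).
Proof.
exists U, h, (fun x h => h); split => //=.
by rewrite -hom_compA open_incl_le_comp.
Qed.

Definition rep_preimage (S : scheme) (X Y : scheme_over S) (r : rep X Y)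
  (V : opens Y) : opens X := image_open (hom_preimage r V).

Lemma rep_preimageP (S : scheme) (X Y : scheme_over S) (r : rep X Y)
    (V : opens Y) (U : opens X) (h : U `<=` dom r) (x : open_subscheme U) :
  rep_preimage r V (val x) -> V (r (open_incl_le h x)).
Proof.
by case=> y Vy yx; rewrite (_ : open_incl_le h x = y) //; exact: val_inj.
Qed.

Lemma diffuse_preimage (S : scheme) (X Y : scheme_over S) (r : rep X Y)
  (V : opens Y) : diffuse r -> S_dense V -> S_dense (rep_preimage r V).
Proof. by move=> dr dV; apply: S_dense_trans; [exact: dom_dense|exact: dr]. Qed.

(** The diffuse representative r0 may differ from r and r'; it only serves to
    produce an S-dense open of X on which r and r' map into the open where q and
    q' agree. This is how diffuseness of a single representative suffices. *)
Lemma rep_comp_equiv (S : scheme) (X Y Z : scheme_over S) (r0 r r' : rep X Y)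
    (q q' : rep Y Z) (h : composable r q) (h' : composable r' q') :
  diffuse r0 -> rep_equiv r0 r -> rep_equiv r r' -> rep_equiv q q' ->
  rep_equiv (rep_comp h) (rep_comp h').
Proof.
move=> dr0 [U [hU0 [hU [dU EU]]]] [U' [hU' [hU'' [dU' EU']]]].
move=> [V [hV [hV' [dV EV]]]].
pose W := opensI (rep_preimage r0 V) (opensI U U').
have WU : W `<=` U by move=> x [_ []].
have WU' : W `<=` U' by move=> x [_ []].
have k : W `<=` dom r by move=> x /WU /hU.
have k' : W `<=` dom r' by move=> x /WU' /hU''.
exists W, k, k'; split.
  by apply: S_denseI; [exact: diffuse_preimage|exact: S_denseI].
pose t := hom_comp r (open_incl_le k).
have tE' : t = hom_comp r' (open_incl_le k').
  rewrite /t -(open_incl_le_comp WU' hU') -(open_incl_le_comp WU' hU'').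
  by rewrite !hom_compA EU'.
have k0 : W `<=` dom r0 by move=> x /WU /hU0.
have tE0 : t = hom_comp r0 (open_incl_le k0).
  rewrite /t -(open_incl_le_comp WU hU) -(open_incl_le_comp WU hU0).
  by rewrite !hom_compA EU.
have tV x : V (t x).
  by rewrite tE0; apply: rep_preimageP; have [] := set_valP x.
have tq : hom_comp (hom_corestrict h) (open_incl_le k) =
          hom_comp (open_incl_le hV) (hom_corestrict tV).
  by apply: open_incl_mono; rewrite !hom_compA !open_incl_corestrict.
have tq' : hom_comp (hom_corestrict h') (open_incl_le k') =
          hom_comp (open_incl_le hV') (hom_corestrict tV).
  by apply: open_incl_mono; rewrite !hom_compA !open_incl_corestrict.
by rewrite /= -!hom_compA tq tq' !hom_compA EV.
Qed.

Theorem mainTheorem9 (S : scheme) (X Y Z : scheme_over S)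
    (phi : rational X Y) (psi : rational Y Z) (phi_diffuse : rational_diffuse phi) :
  (exists (r : rep X Y) (q : rep Y Z), [/\ phi r, psi q & composable r q]) /\
  (forall (r r' : rep X Y) (q q' : rep Y Z)
     (h : composable r q) (h' : composable r' q'),
     phi r -> phi r' -> psi q -> psi q' ->
     rational_of (rep_comp h) = rational_of (rep_comp h')).
Proof.
case: phi_diffuse => r0 phi_r0 dr0; split; last first.
  move=> r r' q q' h h' phi_r phi_r' psi_q psi_q'; apply: rational_of_eq.
  apply: (rep_comp_equiv h h' dr0); first exact/(rational_equiv _ phi_r0).
    exact/(rational_equiv _ phi_r).
  exact/(rational_equiv _ psi_q).
have [q psi_q] := rational_rep psi.
have k : rep_preimage r0 (dom q) `<=` dom r0 by exact: image_open_sub.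
have dW := diffuse_preimage dr0 (@dom_dense _ _ _ q).
exists (rep_restrict dW k), q; split => //.
  by apply/(rational_equiv _ phi_r0); exact: rep_restrict_equiv.
by move=> x; apply: rep_preimageP; exact: set_valP.
Qed.
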